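(* Let $f:2^N\to\mathbb{R}_{\ge 0}$ be a normalized monotone submodular function with $|N|=n$, let $a:N\to[0,1]$ be a cost vector, and let $\varepsilon>0$. In $O\!\left(\frac{\log n}{\varepsilon^2}\right)$ depth (adaptive rounds), one can compute a $(1-O(\varepsilon))(1-e^{-1})$-multiplicative approximation to $\max\{f(S): S\subseteq N,\ \sum_{j\in S}a_j\le 1\}$.
   Context: Submodular: $f(A)+f(B)\ge f(A\cup B)+f(A\cap B)$ for all $A,B\subseteq N$; monotone: $S\subseteq T\Rightarrow f(S)\le f(T)$; normalized: $f(\emptyset)=0$. The function is accessed through a value oracle; depth is the number of sequential rounds of oracle queries, where each query in a round depends only on answers to queries in earlier rounds. *)

(* Defs.v *)
From HB Require Import structures.
From mathcomp Require Import all_boot all_order all_algebra.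
From mathcomp Require Import interval_inference reals.

Set Implicit Arguments.
Unset Strict Implicit.
Unset Printing Implicit Defensive.

Import Order.TTheory GRing.Theory Num.Theory.
Local Open Scope ring_scope.

Section SetFunctions.
Variables (R : realType) (N : finType).
Implicit Types (f : {set N} -> R) (a : N -> R) (S : {set N}).

Definition submodular f :=
  forall A B : {set N}, f (A :|: B) + f (A :&: B) <= f A + f B.

Definition monotone f := forall S T : {set N}, S \subset T -> f S <= f T.

Definition normalized f := f set0 = 0.

Definition nonnegative f := forall S, 0 <= f S.

Definition feasible a S : bool := \sum_(j in S) a j <= 1.

(* For nonnegative f and a this is the maximum of f over the feasible sets:
   set0 is feasible, and the default value 0 is at most f set0. *)
Definition knapsack_opt a f : R := \big[Num.max/0]_(S | feasible a S) f S.

Definition knapsack_approx a f (alpha : R) S : bool :=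
  feasible a S && (alpha * knapsack_opt a f <= f S).

End SetFunctions.

(* Randomized algorithms with value-oracle access to a function
   {set N} -> R, as decision trees.  [Round Q k] submits the whole batch Q in
   one adaptive round and continues with the list of its answers, in the order
   of Q; hence the queries of a round depend only on earlier answers and coins.
   [Flip p k] tosses a coin that shows true with probability p, independently
   of all other coins. *)
Inductive oracle_alg (R : realType) (N : finType) : Type :=
| Output of {set N}
| Round of seq {set N} & (seq R -> oracle_alg R N)
| Flip of {i01 R} & (bool -> oracle_alg R N).

Section OracleAlg.
Variables (R : realType) (N : finType).
Implicit Types (f : {set N} -> R) (alg : oracle_alg R N).

(* Number of adaptive rounds with oracle f, in the worst case over coins. *)
Fixpoint depth f alg : nat :=
  match alg with
  | Output _ => 0
  | Round Q k => (depth f (k (map f Q))).+1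
  | Flip _ k => maxn (depth f (k true)) (depth f (k false))
  end.

(* Total number of queries to f, in the worst case over coins. *)
Fixpoint nqueries f alg : nat :=
  match alg with
  | Output _ => 0
  | Round Q k => size Q + nqueries f (k (map f Q))
  | Flip _ k => maxn (nqueries f (k true)) (nqueries f (k false))
  end.

(* Probability, over the coins, that the set output with oracle f lies in E. *)
Fixpoint output_prob f alg (E : pred {set N}) : R :=
  match alg with
  | Output A => (E A)%:R
  | Round Q k => output_prob f (k (map f Q)) E
  | Flip p k => p%:num * output_prob f (k true) E
              + (1 - p%:num) * output_prob f (k false) E
  end.

End OracleAlg.

(* Main.v *)
Require Import Defs.
From HB Require Import structures.
From mathcomp Require Import all_boot all_order all_algebra.
From mathcomp Require Import interval_inference reals sequences exp.
From mathcomp Require Import ring lra zify.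

Set Implicit Arguments.
Unset Strict Implicit.
Unset Printing Implicit Defensive.

Import Order.TTheory GRing.Theory Num.Theory.
Local Open Scope ring_scope.

(** Elements of cost zero can be taken for free.  Fix an optimal set [opt] and
    guess three of its elements greedily, so that afterwards every element of
    [opt] has marginal value at most a third of the value of the guessed set
    [base]; guess also, within a factor 2, the value that [opt] adds to [base].
    With budget [b] left, lower a density threshold by factors [1 - eps] from
    (value to gain) / [b] to a constant fraction of it, in O(1 / eps) levels.

    Within a level, let [X] be the elements whose density is above the
    threshold.  Order [X] at random, drawing without replacement with weights
    [1 / a], query all prefixes in one round, and add the shortest prefix after
    which at most [(1 - eps) #|X|] elements of [X] remain dense; thus
    O(log n / eps) rounds empty [X].  Before that point each drawn element is
    dense with probability at least [1 - eps] relative to cost, so that the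
    cost wasted on elements that are not dense is at most [eps] times the cost
    spent, in expectation, and by Markov's inequality it is O(eps b) with
    probability 1/2.  The rest of the cost closes the gap to [opt] at the rate
    of the continuous greedy algorithm, hence the factor [1 - 1/e] once the
    budget is exceeded.  The element that exceeds it is discarded, at a loss of
    at most [f base / 3], affordable since [2/3 >= 1 - 1/e].

    All guesses, and enough independent copies of each to bring the failure
    probability below [delta], run in parallel. *)

(** * Programs with oracle access and coins *)

(* [oracle_alg] with results of any type, so that programs can be sequenced. *)
Inductive prog (R : realType) (N : finType) (T : Type) : Type :=
| Ret of T
| Ask of seq {set N} & (seq R -> prog R N T)
| Toss of {i01 R} & (bool -> prog R N T).

Arguments Ret {R N T}.
Arguments Ask {R N T}.
Arguments Toss {R N T}.

Section Programs.
Variables (R : realType) (N : finType).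
Implicit Types (f F : {set N} -> R) (Q : seq {set N}).
Local Notation prog := (prog R N).

Fixpoint bind T U (c : prog T) (k : T -> prog U) : prog U :=
  match c with
  | Ret x => k x
  | Ask Q h => Ask Q (fun r => bind (h r) k)
  | Toss p h => Toss p (fun b => bind (h b) k)
  end.

Fixpoint alg_of (c : prog {set N}) : oracle_alg R N :=
  match c with
  | Ret A => Output R A
  | Ask Q h => Round Q (fun r => alg_of (h r))
  | Toss p h => Flip p (fun b => alg_of (h b))
  end.

Fixpoint expect f T (c : prog T) (g : T -> R) : R :=
  match c with
  | Ret x => g x
  | Ask Q h => expect f (h (map f Q)) g
  | Toss p h => p%:num * expect f (h true) g
              + (1 - p%:num) * expect f (h false) g
  end.

(* On oracle [f], at most [d] rounds and [q] queries are made, and every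
   result, even one of probability zero, satisfies [P]. *)
Fixpoint runs f T (P : T -> Prop) (d q : nat) (c : prog T) : Prop :=
  match c with
  | Ret x => P x
  | Ask Q h => [/\ (0 < d)%N, (size Q <= q)%N
                 & runs f P d.-1 (q - size Q) (h (map f Q))]
  | Toss p h => runs f P d q (h true) /\ runs f P d q (h false)
  end.

Lemma expect_bind f T U (c : prog T) (k : T -> prog U) g :
  expect f (bind c k) g = expect f c (fun x => expect f (k x) g).
Proof. by elim: c => //= p h IH; rewrite !IH. Qed.

Lemma expect_affine f T (c : prog T) (x y : R) (g : T -> R) :
  expect f c (fun t => x * g t + y) = x * expect f c g + y.
Proof. by elim: c => //= p h IH; rewrite !IH; ring. Qed.

(** Turns an invariant proved by [runs] into a bound on expectations: the integrands are compared
    only where it holds. *)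
Lemma expect_le f T (P : T -> Prop) d q (c : prog T) (g1 g2 : T -> R) :
  runs f P d q c -> (forall t, P t -> g1 t <= g2 t) ->
  expect f c g1 <= expect f c g2.
Proof.
move=> + le_g; elim: c d q => /= [t|Q h IH|p h IH] d q.
- exact: le_g.
- by case=> _ _; apply: IH.
- case=> rt rf; apply: lerD; apply: ler_wpM2l; rewrite ?subr_ge0 //.
    exact: IH rt.
  exact: IH rf.
Qed.

Lemma expect_mono f T (c : prog T) (g1 g2 : T -> R) :
  (forall t, g1 t <= g2 t) -> expect f c g1 <= expect f c g2.
Proof.
move=> le_g; elim: c => //= p h IH.
by apply: lerD; apply: ler_wpM2l (IH _) => //; rewrite subr_ge0.
Qed.

Lemma eq_expect f T (c : prog T) (g1 g2 : T -> R) :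
  g1 =1 g2 -> expect f c g1 = expect f c g2.
Proof. by move=> e; elim: c => //= p h IH; rewrite !IH. Qed.

Lemma expect_cst f T (c : prog T) (x : R) : expect f c (fun=> x) = x.
Proof. by elim: c => //= p h IH; rewrite !IH; ring. Qed.

Lemma runs_weaken f T (P P' : T -> Prop) d d' q q' (c : prog T) :
  (d <= d')%N -> (q <= q')%N -> (forall t, P t -> P' t) ->
  runs f P d q c -> runs f P' d' q' c.
Proof.
move=> + + PP'; elim: c d d' q q' => /= [t|Q h IH|p h IH] d d' q q' dd qq.
- exact: PP'.
- case=> d0 Qq r; split; [lia|lia|].
  by apply: IH r; lia.
- by case=> rt rf; split; apply: (IH _ d d' q q').
Qed.

Lemma runs_bind f T U (P : T -> Prop) (P' : U -> Prop) d1 d2 q1 q2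
    (c : prog T) (k : T -> prog U) :
  runs f P d1 q1 c -> (forall x, P x -> runs f P' d2 q2 (k x)) ->
  runs f P' (d1 + d2) (q1 + q2) (bind c k).
Proof.
move=> + Hk; elim: c d1 q1 => /= [x|Q h IH|p h IH] d1 q1.
- by move=> /Hk; apply: runs_weaken => //; lia.
- case=> d0 Qq r; split; [lia|lia|].
  have -> : (d1 + d2).-1 = (d1.-1 + d2)%N by lia.
  have -> : (q1 + q2 - size Q = q1 - size Q + q2)%N by lia.
  exact: IH.
- by case=> rt rf; split; apply: IH.
Qed.

Lemma runs_alg_of f P d q (c : prog {set N}) : runs f P d q c ->
  (depth f (alg_of c) <= d)%N /\ (nqueries f (alg_of c) <= q)%N.
Proof.
elim: c d q => //= [Q h IH|p h IH] d q.
- by case=> d0 Qq /IH[]; lia.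
- by case=> /IH[? ?] /IH[? ?]; rewrite !geq_max; split; apply/andP.
Qed.

Lemma output_prob_alg_of f (c : prog {set N}) (E : pred {set N}) :
  output_prob f (alg_of c) E = expect f c (fun A => (E A)%:R).
Proof. by elim: c => //= p h IH; rewrite !IH. Qed.

(** Presents the answers as a set function, so that programs can be written for an arbitrary [F]; it
    is faithful only on the queried sets. *)
Definition lookup Q (r : seq R) (A : {set N}) : R := nth 0 r (index A Q).

Lemma lookupE f Q : {in Q, lookup Q (map f Q) =1 f}.
Proof.
by move=> A AQ; rewrite /lookup (nth_map A) ?index_mem // nth_index.
Qed.

Definition ask T Q (k : ({set N} -> R) -> prog T) : prog T :=
  Ask Q (fun r => k (lookup Q r)).

Fixpoint iterate T (step : nat -> T -> prog T) n (x : T) : prog T :=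
  if n is n'.+1 then bind (iterate step n' x) (step n') else Ret x.

Lemma runs_iterate f T (I : nat -> T -> Prop) step d q n x :
  I 0%N x ->
  (forall i y, I i y -> runs f (I i.+1) d q (step i y)) ->
  runs f (I n) (n * d) (n * q) (iterate step n x).
Proof.
move=> I0 Istep; elim: n => //= n IH.
by rewrite !mulSnr; apply: runs_bind IH _ => y; apply: Istep.
Qed.

(** Tower rule for a supermartingale: [phi] does not rise in expectation from any state, reachable
    or not. *)
Lemma expect_iterate f T (phi : T -> R) step n x :
  (forall i y, expect f (step i y) phi <= phi y) ->
  expect f (iterate step n x) phi <= phi x.
Proof.
move=> Hstep; elim: n => //= n IH; rewrite expect_bind.
by apply: le_trans IH; apply: expect_mono.
Qed.

(* Runs both programs in lockstep, so that rounds are shared. *)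
Fixpoint par T (c1 : prog T) : prog (seq T) -> prog (seq T) :=
  match c1 with
  | Ret x => fun c2 => bind c2 (fun l => Ret (x :: l))
  | Toss p h => fun c2 => Toss p (fun b => par (h b) c2)
  | Ask Q1 h1 => fix aux (c2 : prog (seq T)) :=
      match c2 with
      | Ret l => Ask Q1 (fun r => bind (h1 r) (fun x => Ret (x :: l)))
      | Toss p h => Toss p (fun b => aux (h b))
      | Ask Q2 h2 => Ask (Q1 ++ Q2) (fun r =>
          par (h1 (take (size Q1) r)) (h2 (drop (size Q1) r)))
      end
  end.

Definition parallel T (cs : seq (prog T)) : prog (seq T) :=
  foldr (@par T) (Ret [::]) cs.

Lemma runs_par f T (P1 : T -> Prop) (P2 P : seq T -> Prop) d q1 q2 c1 c2 :
  (forall x l, P1 x -> P2 l -> P (x :: l)) ->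
  runs f P1 d q1 c1 -> runs f P2 d q2 c2 ->
  runs f P d (q1 + q2) (par c1 c2).
Proof.
move=> HP; elim: c1 d q1 q2 c2 => /= [x|Q1 h1 IH|p h1 IH] d q1 q2 c2.
- move=> P1x r2; rewrite addnC -(addn0 d).
  apply: (runs_bind r2) => l P2l /=.
  exact: HP.
- move=> [d0 Qq r1]; elim: c2 q2 => /= [l|Q2 h2 _|p h2 IH2] q2.
  + move=> P2l; split => //; first by lia.
    apply: (@runs_weaken _ _ P P (d.-1 + 0) _ (q1 - size Q1 + 0)) => //; [lia..|].
    apply: runs_bind r1 _ => x P1x /=.
    exact: HP.
  + case=> _ Qq2 r2; split=> //; first by rewrite size_cat; lia.
    rewrite map_cat take_size_cat ?size_map // drop_size_cat ?size_map //.
    have -> : (q1 + q2 - size (Q1 ++ Q2) = (q1 - size Q1) + (q2 - size Q2))%N.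
      by rewrite size_cat; lia.
    exact: IH.
  + by case=> rt rf; split; apply: IH2.
- by case=> rt rf r2; split; apply: IH.
Qed.

(** The coins of the two programs are independent, and in a shared round each receives exactly its
    own answers; hence product test functions factor. *)
Lemma expect_par f T (g1 : T -> R) (g2 g : seq T -> R) c1 c2 :
  (forall x l, g (x :: l) = g1 x * g2 l) ->
  expect f (par c1 c2) g = expect f c1 g1 * expect f c2 g2.
Proof.
move=> Hg; elim: c1 c2 => /= [x|Q1 h1 IH|p h1 IH] c2.
- rewrite expect_bind -[RHS]addr0 -expect_affine; apply: eq_expect => l /=.
  by rewrite Hg addr0.
- elim: c2 => /= [l|Q2 h2 _|p h2 IH2].
  + rewrite expect_bind mulrC -[RHS]addr0 -expect_affine.
    by apply: eq_expect => x /=; rewrite Hg addr0 mulrC.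
  + by rewrite map_cat take_size_cat ?size_map // drop_size_cat ?size_map.
  + by rewrite !IH2; ring.
- by rewrite !IH; ring.
Qed.


Lemma runs_parallel f T (I : Type) d q (br : I -> prog T) (s : seq I) :
  (forall i, runs f (fun=> True) d q (br i)) ->
  runs f (fun l => size l = size s) d (size s * q) (parallel (map br s)).
Proof.
move=> H; elim: s => //= i s IH; rewrite mulSn.
by apply: runs_par (H i) IH => x l _ /= ->.
Qed.

Lemma expect_parallel_all f T (I : Type) (br : I -> prog T) (s : seq I)
    (E : pred T) :
  expect f (parallel (map br s)) (fun l => (all E l)%:R) =
  \prod_(i <- s) expect f (br i) (fun x => (E x)%:R).
Proof.
elim: s => [|i s IH] /=; first by rewrite big_nil.
rewrite big_cons -IH; apply: expect_par => x l /=.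
by rewrite -natrM mulnb.
Qed.

End Programs.

(** * Submodular functions and random orders *)

Section Marginals.
Variables (R : realType) (N : finType) (f : {set N} -> R).
Hypotheses (fmono : monotone f) (fsub : submodular f).
Implicit Types (x : N) (A B T : {set N}).

Definition gain (F : {set N} -> R) x (A : {set N}) : R := F (x |: A) - F A.

Lemma gain_ge0 x A : 0 <= gain f x A.
Proof. by rewrite subr_ge0 fmono // subsetUr. Qed.

Lemma gain_mem x A : x \in A -> gain f x A = 0.
Proof. by move=> xA; rewrite /gain (setUidPr _) ?subrr // sub1set. Qed.

(** Submodularity for [x |: A] and [B]; monotonicity handles an intersection that also contains
    [x]. *)
Lemma gain_anti x A B : A \subset B -> gain f x B <= gain f x A.
Proof.
move=> AB; have := fsub (x |: A) B.
rewrite -setUA (setUidPr AB) => h.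
have : f A <= f ((x |: A) :&: B) by apply: fmono; rewrite subsetI subsetUr.
by rewrite /gain; lra.
Qed.

(** Add [T] one element at a time; by [gain_anti] each gains no more than it would at [A]. *)
Lemma le_sum_gain A T : f (A :|: T) <= f A + \sum_(x in T) gain f x A.
Proof.
move: {2}#|T| (leqnn #|T|) => n; elim: n T => [|n IH] T.
  rewrite leqn0 cards_eq0 => /eqP->.
  by rewrite setU0 big_set0 addr0.
case: (set_0Vmem T) => [-> _|[x xT] Tn]; first by rewrite setU0 big_set0 addr0.
rewrite (big_setD1 x xT) /=.
have /IH IHT : (#|T :\ x| <= n)%N by move: Tn; rewrite (cardsD1 x) xT.
have : gain f x (A :|: T :\ x) <= gain f x A.
  by apply: gain_anti; rewrite subsetUl.
rewrite {1}/gain.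
have -> : x |: (A :|: T :\ x) = A :|: T by rewrite setUCA setD1K.
lra.
Qed.

End Marginals.

Section Sampling.
Variables (R : realType) (N : finType).
Implicit Types (f : {set N} -> R) (w : N -> R) (Z : {set N}).

(* Has bias 0 when [x] is not in [0, 1]. *)
Definition coin (x : R) : {i01 R} :=
  match @idP (0 <= x <= 1) with
  | ReflectT h => Itv01 (proj1 (andP h)) (proj2 (andP h))
  | ReflectF _ => Itv01 (lexx 0) ler01
  end.

Lemma coinE x : 0 <= x <= 1 -> (coin x)%:num = x.
Proof. by rewrite /coin; case: {-}_ / idP. Qed.

(** Successive biased coins realize one weighted draw: each element in turn is accepted with its
    share of the weight still left. *)
Fixpoint sample w x (z : seq N) : prog R N N :=
  if z is y :: z' then
    Toss (coin (w x / \sum_(i <- x :: z) w i))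
         (fun b => if b then Ret x else sample w y z')
  else Ret x.

Lemma runs_sample f w x z : runs f (fun y => y \in x :: z) 0 0 (sample w x z).
Proof.
elim: z x => [|y z IH] x /=; first by rewrite mem_head.
split; first by rewrite mem_head.
by apply: runs_weaken (IH y) => // t t_yz; rewrite in_cons t_yz orbT.
Qed.

Lemma expect_sample f w x z g : {in x :: z, forall i, 0 < w i} ->
  (\sum_(i <- x :: z) w i) * expect f (sample w x z) g =
  \sum_(i <- x :: z) w i * g i.
Proof.
elim: z x => [|y z IH] x w0; first by rewrite /= !big_seq1.
have wyz : {in y :: z, forall i, 0 < w i}.
  by move=> i iz; apply: w0; rewrite in_cons iz orbT.
have wx : 0 < w x by rewrite w0 ?mem_head.
rewrite [RHS]big_cons -IH //= !(big_cons _ _ x).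
set W := \sum_(i <- y :: z) w i.
have W0 : 0 < W.
  rewrite /W big_cons; apply: ltr_wpDr; last by rewrite wyz ?mem_head.
  rewrite big_seq; apply: sumr_ge0 => i iz.
  by apply/ltW/wyz; rewrite in_cons iz orbT.
rewrite coinE; first by field; lra.
by rewrite divr_ge0 ?ler_pdivrMr ?mul1r ?lerDl; lra.
Qed.

(* Orders [Z] at random, drawing without replacement proportionally to [w]. *)
Fixpoint draw w k (Z : {set N}) : prog R N (seq N) :=
  match k, enum Z with
  | k'.+1, x :: z => bind (sample w x z) (fun y =>
      bind (draw w k' (Z :\ y)) (fun s => Ret (y :: s)))
  | _, _ => Ret [::]
  end.

Lemma runs_draw f w k Z : (#|Z| <= k)%N ->
  runs f (fun s => s =i Z /\ (size s <= k)%N) 0 0 (draw w k Z).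
Proof.
elim: k Z => [|k IH] Z Zk /=.
  by split=> // i; move: Zk; rewrite leqn0 cards_eq0 => /eqP->; rewrite inE.
case eZ: (enum Z) => [|x z] /=.
  by split=> // i; rewrite -[RHS]mem_enum eZ.
apply: (@runs_bind _ _ _ _ _ _ _ 0 0 0 0 _ _ (runs_sample f w x z)) => y.
rewrite -eZ mem_enum => yZ.
have /IH H : (#|Z :\ y| <= k)%N by move: Zk; rewrite (cardsD1 y Z) yZ.
apply: (@runs_bind _ _ _ _ _ _ _ 0 0 0 0 _ _ H) => s [sZ sk] /=.
split=> // i; rewrite in_cons sZ in_setD1.
by case: eqVneq => //= ->.
Qed.

End Sampling.

(** * One adaptive step *)

(* [out] is the last set within the budget on the way to [cur], [spent] the
   cost added so far, and [wasted] the part of it that went to elements whose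
   density was below the threshold when they were added. *)
Record state (R : realType) (N : finType) := State
  { cur : {set N}; out : {set N}; spent : R; wasted : R }.

Section Step.
Variables (R : realType) (N : finType) (a : N -> R) (b eps : R).
Implicit Types (F f : {set N} -> R) (A X Z : {set N}) (x : N) (s : seq N).
Implicit Types (st : state R N) (tau : R).

Definition dense F tau A X := [set x in X | tau * a x <= gain F x A].

Definition push F tau x st : state R N :=
  let c := spent st + a x in
  State (x |: cur st) (if c <= b then x |: cur st else out st) c
        (wasted st + if tau * a x <= gain F x (cur st) then 0 else a x).

(** The second alternative makes the dense set shrink geometrically; its failure is what bounds the
    expected waste of the next draw. *)
Definition stop F tau X st : bool :=
  (b < spent st) || (#|dense F tau (cur st) X|%:R <= (1 - eps) * #|X|%:R).

Fixpoint advance F tau X s st : state R N :=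
  if s is x :: s' then
    if stop F tau X st then st else advance F tau X s' (push F tau x st)
  else st.

(** The sets whose values determine all gains at [A]. *)
Definition around A : seq {set N} := A :: [seq x |: A | x <- enum N].

Fixpoint prefixes A s : seq {set N} :=
  around A ++ (if s is x :: s' then prefixes (x |: A) s' else [::]).

(** The first round finds the dense elements; the second evaluates all gains at all prefixes of the
    random order, after which [advance] needs no further query. *)
Definition step cands tau st : prog R N (state R N) :=
  ask (around (cur st)) (fun F => let X := dense F tau (cur st) cands in
  bind (draw (fun x => (a x)^-1) #|N| X) (fun s =>
  ask (prefixes (cur st) s) (fun F' => Ret (advance F' tau X s st)))).

Definition step_queries := (#|N|.+1 + #|N|.+1 * #|N|.+1)%N.

Lemma size_around A : size (around A) = #|N|.+1.
Proof. by rewrite /= size_map -cardE. Qed.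

Lemma size_prefixes A s : size (prefixes A s) = (#|N|.+1 * (size s).+1)%N.
Proof.
elim: s A => [|x s IH] A; rewrite /prefixes -/prefixes size_cat size_around.
  by rewrite muln1 addn0.
by rewrite /= IH !mulnS.
Qed.

Lemma eq_gain F F' A x : {in around A, F =1 F'} -> gain F x A = gain F' x A.
Proof.
move=> e; rewrite /gain !e ?mem_head // in_cons.
by apply/orP; right; apply: map_f; rewrite mem_enum.
Qed.

Lemma eq_dense F F' tau A X : {in around A, F =1 F'} ->
  dense F tau A X = dense F' tau A X.
Proof. by move=> e; apply/setP => x; rewrite !inE (eq_gain _ e). Qed.

Lemma eq_advance F F' tau X s st : {in prefixes (cur st) s, F =1 F'} ->
  advance F tau X s st = advance F' tau X s st.
Proof.
elim: s st => // x s IH st e.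
have e1 : {in around (cur st), F =1 F'}.
  by move=> A h; apply: e; rewrite /prefixes mem_cat h.
rewrite /= /stop (eq_dense _ _ e1); case: ifP => // _.
rewrite /push (eq_gain _ e1); apply: IH => A h; apply: e.
by rewrite /prefixes -/prefixes mem_cat h orbT.
Qed.

Lemma stop_advance F tau X s st : stop F tau X st -> advance F tau X s st = st.
Proof. by case: s => [|x s] /= => [|->]. Qed.

Lemma runs_step f (P : state R N -> Prop) cands tau st :
  (forall s, s =i dense f tau (cur st) cands ->
     P (advance f tau (dense f tau (cur st) cands) s st)) ->
  runs f P 2 step_queries (step cands tau st).
Proof.
move=> H; rewrite /step /ask /= size_map -cardE; split=> //.
  exact: leq_addr.
set F := lookup _ _.
have -> : dense F tau (cur st) cands = dense f tau (cur st) cands.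
  by apply: eq_dense; apply: lookupE.
set X := dense _ _ _ _.
have -> : (step_queries - #|N|.+1 = 0 + #|N|.+1 * #|N|.+1)%N.
  by rewrite /step_queries addKn.
apply: (runs_bind (d1 := 0) (d2 := 1) (runs_draw f _ (max_card _))).
move=> s [sX sN]; rewrite /= size_prefixes leq_mul2l ltnS; split; rewrite ?sN ?orbT //.
rewrite (eq_advance (F' := f)); first exact: H.
exact: lookupE.
Qed.

Lemma expect_step f cands tau st phi :
  let X := dense f tau (cur st) cands in
  expect f (step cands tau st) phi =
  expect f (draw (fun x => (a x)^-1) #|N| X)
    (fun s => phi (advance f tau X s st)).
Proof.
move=> X; rewrite /step /ask [LHS]/= expect_bind.
rewrite (eq_dense (F' := f)); last exact: lookupE.
apply: eq_expect => s /=; rewrite (eq_advance (F' := f)) //.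
exact: lookupE.
Qed.

(** Potential for the waste: adding [x] changes it by [- eps * a x] if [x] is dense and by
    [(1 - eps) * a x] otherwise. *)
Definition excess st := wasted st - eps * spent st.

Section Expectation.
Variables (f : {set N} -> R) (cands : {set N}) (tau : R).
Hypotheses (eps1 : eps <= 1) (tau0 : 0 < tau).

(* Weights 1 / a make the expected wasted cost of a draw, relative to its
   expected cost, the fraction of the remaining elements that are not dense. *)
Lemma expect_draw_excess X k Z st :
  {in X, forall x, 0 < a x} -> Z \subset X -> X :\: Z \subset cur st ->
  expect f (draw (fun x => (a x)^-1) k Z)
    (fun s => excess (advance f tau X s st)) <= excess st.
Proof.
move=> aX; elim: k Z st => [|k IH] Z st ZX XZ //=.
case eZ: (enum Z) => [|x z] //=.
rewrite expect_bind.
have [stp|nstp] := boolP (stop f tau X st).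
  under eq_expect => y do (rewrite expect_bind /=;
    under eq_expect => s do rewrite stp).
  by under eq_expect => y do rewrite expect_cst; rewrite expect_cst.
have az y : y \in x :: z -> 0 < a y.
  by rewrite -eZ mem_enum => yZ; apply/aX/(subsetP ZX).
have runsc := runs_sample f (fun x => (a x)^-1) x z.
apply: (@le_trans _ _ (expect f (sample (fun x => (a x)^-1) x z)
   (fun y => excess (push f tau y st)))).
  apply: (expect_le runsc) => y; rewrite -eZ mem_enum => yZ.
  rewrite expect_bind /=.
  under eq_expect => s do rewrite (negbTE nstp).
  apply: IH; first by apply: subset_trans ZX; apply: subsetDl.
  apply/subsetP => i; rewrite !inE negb_and negbK => /andP[/orP[->//|iZ] iX].
  by rewrite (subsetP XZ) ?orbT // inE iZ.
have w0 : {in x :: z, forall i, 0 < (a i)^-1}.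
  by move=> i iz; rewrite invr_gt0 az.
have W0 : 0 < \sum_(i <- x :: z) (a i)^-1.
  rewrite big_cons; apply: ltr_wpDr; last by rewrite w0 ?mem_head.
  rewrite big_seq; apply: sumr_ge0 => i iz.
  by apply/ltW/w0; rewrite in_cons iz orbT.
rewrite -(ler_pM2l W0) expect_sample // mulr_suml -eZ.
pose D := dense f tau (cur st) X.
(* Dense elements are still undrawn: those of [X] outside [Z] are in the current set and have gain
   0. *)
have DZ : D \subset Z.
  apply/subsetP => i; rewrite inE => /andP[iX]; apply: contraTT => iZ.
  rewrite gain_mem; first by rewrite -ltNge mulr_gt0 // aX.
  by rewrite (subsetP XZ) // inE iZ.
(* The weight cancels the cost, so that only the number of dense elements matters. *)
have termE : {in enum Z, forall i, (a i)^-1 * excess (push f tau i st) =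
    (a i)^-1 * excess st + ((i \notin D)%:R - eps)}.
  move=> i; rewrite mem_enum => iZ; have iX := subsetP ZX _ iZ.
  have ai := lt0r_neq0 (aX _ iX).
  rewrite /excess /push /= inE iX /=.
  by case: ifP => _ /=; field.
rewrite (eq_big_seq _ termE) big_split /= gerDl.
rewrite big_enum /= (eq_bigr (fun i => (1 - eps) - (i \in D)%:R)); last first.
  by move=> i _; case: (i \in D) => /=; ring.
rewrite sumrB sumr_const -natr_sum -big_mkcondr /= sum1_card.
have -> : #|[pred i in Z | i \in D]| = #|D|.
  apply: eq_card => i; rewrite -[LHS]/((i \in Z) && (i \in D)).
  by case: (boolP (i \in D)) => [/(subsetP DZ)->|]; rewrite ?andbF.
(* Without a stop, [#|D|] exceeds [(1 - eps) * #|X|], hence also [(1 - eps) * #|Z|]. *)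
move: nstp; rewrite /stop negb_or -ltNge => /andP[_].
have := subset_leq_card ZX; rewrite -(ler_nat R) => /(ler_wpM2l (x := 1 - eps)).
rewrite subr_ge0 => /(_ eps1) h1 h2; rewrite subr_le0 -[leLHS]mulr_natr.
exact/ltW/(le_lt_trans h1 h2).
Qed.

Lemma expect_step_excess st : {in cands, forall x, 0 < a x} ->
  expect f (step cands tau st) excess <= excess st.
Proof.
move=> a0; rewrite expect_step; apply: expect_draw_excess.
- by move=> x; rewrite inE => /andP[/a0].
- exact: subxx.
- by rewrite setDv sub0set.
Qed.

End Expectation.
End Step.

(** * Invariants of the greedy algorithm *)

Section Invariant.
Variables (R : realType) (N : finType) (a : N -> R) (b eps : R).
Variables (f : {set N} -> R) (base opt cands : {set N}).
Implicit Types (st : state R N) (tau : R) (x : N) (X : {set N}) (s : seq N).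
Hypotheses (fmono : monotone f) (fsub : submodular f).
Hypotheses (b0 : 0 < b) (eps0 : 0 < eps) (eps1 : eps < 1).
Hypothesis opt_cands : opt \subset cands.
Hypothesis opt_cost : \sum_(j in opt) a j <= b.
Hypothesis base_cost : \sum_(j in base) a j <= 1 - b.
Hypothesis cands_cost : {in cands, forall x, 0 < a x <= b}.
Hypothesis cands_gain : {in cands, forall x, gain f x base <= f base / 3}.

Let top := f (base :|: opt).
Let value := top - f base.

Let value_ge0 : 0 <= value.
Proof. by rewrite subr_ge0 fmono // subsetUl. Qed.

(** The last clause is the continuous greedy bound, with useful cost over [b] as time. The term
    [f base / 3] pays for the one element dropped when the budget is exceeded; that element costs at
    most [b], hence [2 * b]. *)
Definition greedy_inv st : Prop :=
  [/\ base \subset cur st, \sum_(j in cur st) a j <= 1 - b + spent st,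
      \sum_(j in out st) a j <= 1, f (cur st) - f base / 3 <= f (out st)
    & [/\ spent st <= 2 * b, spent st <= b -> out st = cur st, 0 <= wasted st
        & top - f (cur st) <=
          value * expR (- ((1 - eps) * (spent st - wasted st) / b))]].

(** Up to the factor [1 - eps], the threshold is at least the gap over [b], so that a dense element
    closes the gap at the greedy rate. *)
Definition near_top tau st : Prop :=
  b < spent st \/ (1 - eps) * (top - f (cur st)) <= b * tau.

Lemma inv_init : 0 <= f base -> greedy_inv (State base base 0 0).
Proof.
have := base_cost; have := b0 => b1 bc fb.
split=> //=; [lra|lra|lra|split=> //=; first lra].
by rewrite subrr mulr0 mul0r oppr0 expR0 mulr1.
Qed.

Lemma cost_setU1 x (A : {set N}) : 0 <= a x ->
  \sum_(j in x |: A) a j <= \sum_(j in A) a j + a x.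
Proof.
move=> ax; have [xA|xA] := boolP (x \in A).
  by rewrite (setUidPr _) ?sub1set // lerDl.
by rewrite big_setU1 //= addrC.
Qed.

(** A dense [x] gains at least [tau * a x], which is at least [t = (1 - eps) * a x / b] times the
    gap, and [1 - t <= exp (- t)]. An element that is not dense leaves [spent - wasted] unchanged
    and cannot widen the gap. *)
Lemma inv_push tau x st : greedy_inv st -> near_top tau st -> spent st <= b ->
  x \in cands -> greedy_inv (push a b f tau x st).
Proof.
have [bp ep e1] := And3 b0 eps0 eps1.
move=> [bc cc co fo [s2 so w0 gap]] nr sb xc.
have /andP[ax axb] := cands_cost xc.
have outE := so sb.
have g0 : 0 <= gain f x (cur st) := gain_ge0 fmono _ _.
have gE : gain f x (cur st) = f (x |: cur st) - f (cur st) by [].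
have cost' : \sum_(j in x |: cur st) a j <= 1 - b + (spent st + a x).
  by have := cost_setU1 (cur st) (ltW ax); lra.
have fb : f (x |: cur st) - f base / 3 <= f (cur st).
  have := gain_anti fmono fsub x bc; have := cands_gain xc; lra.
have fb0 : 0 <= f base / 3.
  by apply: le_trans (cands_gain xc); apply: gain_ge0.
split; rewrite /push /=.
- by apply: subset_trans bc _; apply: subsetUr.
- exact: cost'.
- by case: ifP => // c_le; lra.
- case: ifP => _; [lra|by rewrite outE].
split; [lra|by move=> ->| |].
  by case: ifP; lra.
case: ifP => [good|_]; last first.
  have -> : spent st + a x - (wasted st + a x) = spent st - wasted st by ring.
  lra.
set u := a x / b; have u0 : 0 <= u by rewrite divr_ge0; lra.
have -> : - ((1 - eps) * (spent st + a x - (wasted st + 0)) / b) =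
  - ((1 - eps) * (spent st - wasted st) / b) + - ((1 - eps) * u).
  by rewrite /u; field; lra.
rewrite expRD mulrA; set E := value * _.
set t := (1 - eps) * u; have t0 : 0 <= t by rewrite mulr_ge0; lra.
have ex := expR_ge1Dx (- t); have ex0 := expR_ge0 (- t).
have E0 : 0 <= E by rewrite mulr_ge0 // expR_ge0.
(* A negative gap meets the bound at once, whose right side is nonnegative. *)
have [neg|pos] := ltP (top - f (cur st)) 0.
  have : 0 <= E * expR (- t) by apply: mulr_ge0.
  lra.
apply: (@le_trans _ _ ((top - f (cur st)) * expR (- t))); last first.
  by apply: ler_wpM2r.
apply: (@le_trans _ _ ((top - f (cur st)) * (1 - t))); last first.
  by apply: ler_wpM2l.
have {}nr : (1 - eps) * (top - f (cur st)) <= b * tau.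
  by case: nr => //; lra.
have : u * ((1 - eps) * (top - f (cur st))) <= u * (b * tau).
  exact: ler_wpM2l.
have -> : u * (b * tau) = tau * a x by rewrite /u; field; lra.
rewrite /t; nra.
Qed.

Lemma near_mono tau st st' : near_top tau st -> cur st \subset cur st' ->
  spent st <= spent st' -> near_top tau st'.
Proof.
move=> nr cc ss; case: nr => [h|h]; first by left; lra.
right; apply: le_trans h; rewrite ler_wpM2l ?subr_ge0 ?(ltW eps1) //.
by rewrite lerD2l lerN2 fmono.
Qed.

Lemma inv_advance tau X s st : {subset s <= cands} ->
  greedy_inv st -> near_top tau st ->
  greedy_inv (advance a b eps f tau X s st) /\
  near_top tau (advance a b eps f tau X s st).
Proof.
elim: s st => //= x s IH st sc ist nst; case: ifP => // nstp.
have xc : x \in cands by apply: sc; rewrite mem_head.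
have sb : spent st <= b.
  by move/negbT: nstp; rewrite /stop negb_or -leNgt => /andP[].
apply: IH; first by move=> i si; apply: sc; rewrite in_cons si orbT.
  exact: inv_push.
apply: (near_mono nst); rewrite /= ?subsetUr // lerDl.
by have /andP[/ltW] := cands_cost xc.
Qed.

(* Once all of [X] has been added, no element of it is dense. *)
Lemma stop_after_advance tau X s st : 0 < tau -> X \subset cands ->
  X \subset cur st :|: [set x in s] ->
  stop a b eps f tau X (advance a b eps f tau X s st).
Proof.
move=> t0 Xc; elim: s st => [|x s IH] st /= Xs; last first.
  case: ifP => // _; apply: IH; apply: subset_trans Xs _ => /=.
  by apply/subsetP => i; rewrite !inE orbCA orbA.
apply/orP; right; rewrite (_ : dense _ _ _ _ _ = set0).
  by rewrite cards0 mulr_ge0 // subr_ge0 ltW.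
apply/setP => i; rewrite !inE; apply/negbTE/negP => /andP[iX].
have ai : 0 < a i by have /andP[] := cands_cost (subsetP Xc _ iX).
rewrite gain_mem ?leNgt ?mulr_gt0 //.
by have := subsetP Xs _ iX; rewrite !inE orbF.
Qed.

Definition level tau k st : Prop :=
  [/\ greedy_inv st, near_top tau st
    & b < spent st \/
      #|dense a f tau (cur st) cands|%:R <= (1 - eps) ^+ k * #|N|%:R].

Lemma cur_advance F tau X s st :
  cur st \subset cur (advance a b eps F tau X s st).
Proof.
elim: s st => //= x s IH st; case: ifP => // _.
by apply: subset_trans (IH _); apply: subsetUr.
Qed.

Lemma runs_step_level tau k st : 0 < tau -> level tau k st ->
  runs f (level tau k.+1) 2 (step_queries N) (step a b eps cands tau st).
Proof.
move=> t0 [ist nst den]; apply: runs_step => s.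
set X := dense _ _ _ _ _ => sX.
have Xc : X \subset cands by apply/subsetP => i; rewrite inE => /andP[].
have sc : {subset s <= cands} by move=> i; rewrite sX => /(subsetP Xc).
have [ist' nst'] := inv_advance X sc ist nst.
split=> //; case: den => [over|den].
  by rewrite stop_advance ?/stop ?over //; left.
have : stop a b eps f tau X (advance a b eps f tau X s st).
  by apply: stop_after_advance => //; apply/subsetP => i iX; rewrite !inE sX iX orbT.
set st' := advance _ _ _ _ _ _ _ _; case/orP => [over|few]; first by left.
right; rewrite exprS -mulrA.
have e0 : 0 <= 1 - eps by rewrite subr_ge0 ltW.
apply: le_trans (ler_wpM2l e0 den); apply: le_trans few.
(* By diminishing returns, a candidate dense now was dense before the step, so it belongs to [X] and
   is counted by [stop]. *)
rewrite ler_nat; apply/subset_leq_card/subsetP => i; rewrite !inE.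
case/andP=> ic dns; rewrite ic dns andbT /=; apply: le_trans dns _.
exact: gain_anti (cur_advance _ _ _ _ _).
Qed.

(** Fewer than one dense candidate means none, so every element of [opt] gains at most [tau] times
    its cost; summing bounds the gap by [tau * b]. *)
Lemma near_next tau k st : 0 < tau -> (1 - eps) ^+ k * #|N|%:R < 1 ->
  level tau k st -> near_top (tau * (1 - eps)) st.
Proof.
move=> t0 small [[bc _ _ _ _] _ [over|few]]; first by left.
right; have {few small} : #|dense a f tau (cur st) cands|%:R < 1 :> R.
  exact: le_lt_trans few small.
rewrite (ltr_nat _ _ 1) ltnS leqn0 cards_eq0 => /eqP none.
rewrite mulrA [leRHS]mulrC ler_wpM2l ?subr_ge0 ?(ltW eps1) //.
have h1 : top <= f (cur st :|: opt) by apply: fmono; apply: setSU.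
have h2 := le_sum_gain fmono fsub (cur st) opt.
have h3 : \sum_(x in opt) gain f x (cur st) <= tau * \sum_(x in opt) a x.
  rewrite mulr_sumr; apply: ler_sum => x xo.
  have /setP/(_ x) := none; rewrite !inE (subsetP opt_cands) //= => /negbT.
  by rewrite -ltNge => /ltW.
have h4 : tau * \sum_(x in opt) a x <= tau * b by rewrite ler_wpM2l // ltW.
lra.
Qed.

End Invariant.

(** * Success of the greedy algorithm *)

Section ExponentialBounds.
Variable R : realType.

Lemma expRN1_bounds : 3^-1 <= expR (- 1 : R) <= 2^-1.
Proof.
apply/andP; split; last first.
  rewrite expRN lef_pV2 ?posrE ?expR_gt0 //.
  by have := expR_ge1Dx (1 : R); lra.
(* Six factors suffice: [(5/6)^6] just exceeds [1/3]. *)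
have -> : - 1 = 6%:R * (- (6%:R^-1)) :> R by field.
rewrite expRM_natl.
have h : 5 / 6 <= expR (- (6%:R^-1) : R).
  by apply: le_trans (expR_ge1Dx _); lra.
have h6 : (5 / 6) ^+ 6 <= expR (- (6%:R^-1)) ^+ 6 :> R.
  by apply: lerXn2r; rewrite ?nnegrE ?expR_ge0 //; lra.
apply: le_trans h6; lra.
Qed.

(** From [exp (- x) >= 1 - x] and [(1 - x) * (1 + 2 * x) >= 1]. *)
Lemma expR_le1D2x (x : R) : 0 <= x <= 2^-1 -> expR x <= 1 + 2 * x.
Proof.
move=> /andP[x0 x2]; have h := expR_ge1Dx (- x).
have e : expR x * expR (- x) = 1 := expRxMexpNx_1 x.
have e0 := expR_ge0 x; nra.
Qed.

Lemma expr_1B_le_expR (x : R) n : 0 <= x <= 1 -> (1 - x) ^+ n <= expR (- (n%:R * x)).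
Proof.
move=> /andP[x0 x1]; rewrite -mulrN expRM_natl.
by apply: lerXn2r; rewrite ?nnegrE ?expR_ge0 ?subr_ge0 // expR_ge1Dx.
Qed.

End ExponentialBounds.

Section Greedy.
Variables (R : realType) (N : finType) (a : N -> R) (b eps lam : R).
Variables (f : {set N} -> R) (base cands : {set N}) (K L : nat).
Implicit Types (st : state R N).

(** The slack [1 - eps] in [near_top] allows the first threshold to be already
    [(1 - eps) * lam / b]. *)
Definition threshold l : R := lam / b * (1 - eps) ^+ l.+1.

Definition greedy : prog R N (state R N) :=
  iterate (fun l => iterate (fun=> step a b eps cands (threshold l)) K) L
    (State base base 0 0).

(** Covers wrong guesses too, which run in parallel with the right one; [runs_greedy] adds the
    invariants for a right guess. *)
Lemma runs_greedy_cost :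
  runs f (fun=> True) (L * (K * 2)) (L * (K * step_queries N)) greedy.
Proof.
apply: (runs_iterate (I := fun _ _ => True)) => // l st _.
apply: (runs_iterate (I := fun _ _ => True)) => // k st' _.
exact: runs_step.
Qed.

Variable opt : {set N}.
Hypotheses (fmono : monotone f) (fsub : submodular f).
Hypotheses (b0 : 0 < b) (eps0 : 0 < eps) (eps1 : eps <= 10^-1).
Hypothesis opt_cands : opt \subset cands.
Hypothesis opt_cost : \sum_(j in opt) a j <= b.
Hypothesis base_cost : \sum_(j in base) a j <= 1 - b.
Hypothesis cands_cost : {in cands, forall x, 0 < a x <= b}.
Hypothesis cands_gain : {in cands, forall x, gain f x base <= f base / 3}.
Hypothesis base0 : 0 <= f base.
Hypothesis top_gt : f base < f (base :|: opt).
Hypothesis lam_ge : f (base :|: opt) - f base <= lam.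
Hypothesis lam_le : lam <= 2 * (f (base :|: opt) - f base).
Hypothesis K_large : (1 - eps) ^+ K * #|N|%:R < 1.
Hypothesis L_large : 2 <= L%:R * eps.

Let eps_lt1 : eps < 1.
Proof. by move: eps1; lra. Qed.

Let threshold_gt0 l : 0 < threshold l.
Proof.
have := top_gt; have := lam_ge; have := eps_lt1 => h1 h2 h3.
by rewrite /threshold mulr_gt0 ?divr_gt0 ?exprn_gt0 //; lra.
Qed.

Lemma runs_greedy :
  runs f (fun st => greedy_inv a b eps f base opt st /\
                    near_top b eps f base opt (threshold L) st)
    (L * (K * 2)) (L * (K * step_queries N)) greedy.
Proof.
apply: (runs_iterate (I := fun l st => greedy_inv a b eps f base opt st /\
                    near_top b eps f base opt (threshold l) st)).
  split; first exact: inv_init.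
  right => /=; rewrite /threshold expr1 mulrA mulrC.
  rewrite ler_wpM2r ?subr_ge0 ?(ltW eps_lt1) //.
  by rewrite mulrCA mulfV ?mulr1 // gt_eqF.
move=> l st [ist nst].
have e1 : threshold l.+1 = threshold l * (1 - eps) by rewrite /threshold exprSr mulrA.
apply: (@runs_weaken _ _ _ _ (level a b eps f base opt cands (threshold l) K)
  _ (K * 2) _ (K * step_queries N)) => //.
  move=> st' lst; split; first by case: lst.
  rewrite e1; exact: (near_next fmono fsub eps_lt1 opt_cands opt_cost
    (threshold_gt0 l) K_large lst).
apply: (runs_iterate (I := level a b eps f base opt cands (threshold l))).
  by split=> //; right; rewrite mul1r ler_nat max_card.
by move=> k st' lst; apply: runs_step_level.
Qed.

Definition good A :=
  feasible a A && ((1 - 10 * eps) * (1 - expR (- 1)) * f (base :|: opt) <= f A).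

(** Over budget, the useful cost is at least [b * (1 - 4 * eps)], and
    [(1 - eps) * (1 - 4 * eps) >= 1 - 5 * eps] bounds the exponent. Within budget, nothing was
    dropped, and the last threshold leaves a gap of at most [2 * exp (-2)] times the value to gain,
    less than [exp (-1)] times it. *)
Lemma final_good st : greedy_inv a b eps f base opt st ->
  near_top b eps f base opt (threshold L) st ->
  wasted st <= 4 * eps * b -> good (out st).
Proof.
have [bp ep e10] := And3 b0 eps0 eps1.
have tg := top_gt; have ll := lam_le; have LL := L_large; have fb := base0.
move=> [_ _ co fo [s2 so w0 gap]] nr wst; rewrite /good /feasible co /=.
have /andP[e3 e2] := expRN1_bounds R.
set e := expR (- 1) in e3 e2 *.
set top := f (base :|: opt) in tg ll gap *.
case: (ltP b (spent st)) => [over|nover].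
  have : expR (- ((1 - eps) * (spent st - wasted st) / b)) <= e * (1 + 10 * eps).
    have : expR (5 * eps) <= 1 + 10 * eps.
      by apply: le_trans (expR_le1D2x _) _; lra.
    move=> h5; apply: (@le_trans _ _ (e * expR (5 * eps))); last first.
      by rewrite ler_wpM2l ?expR_ge0.
    rewrite /e -expRD ler_expR lerNl.
    have : (1 - eps) * (b * (1 - 4 * eps)) / b
        <= (1 - eps) * (spent st - wasted st) / b.
      rewrite ler_pM2r ?invr_gt0 // ler_wpM2l; lra.
    have -> : (1 - eps) * (b * (1 - 4 * eps)) / b = 1 - 5 * eps + 4 * eps ^+ 2.
      by field; lra.
    have := sqr_ge0 eps; lra.
  set E := expR _ in gap *; move=> hE.
  have : (top - f base) * E <= (top - f base) * (e * (1 + 10 * eps)).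
    by rewrite ler_wpM2l; lra.
  (* The slack splits into [20 * eps * (1/2 - e)] per unit of [top - f base] and
     [(1 - 10 * eps) * (e - 1/3) + 20/3 * eps] per unit of [f base]. *)
  have h1 : 0 <= (1 - 10 * eps) * (e - 3^-1) * f base.
    by rewrite !mulr_ge0; lra.
  have h2 : 0 <= eps * (2^-1 - e) * (top - f base) by rewrite !mulr_ge0; lra.
  have h3 : 0 <= eps * f base by rewrite mulr_ge0; lra.
  lra.
rewrite so //.
case: nr => [|nr]; first by lra.
have pw : (1 - eps) ^+ L <= e * e.
  apply: le_trans (expr_1B_le_expR _ _) _; first by lra.
  by rewrite /e -expRD ler_expR; lra.
have h : top - f (cur st) <= lam * (1 - eps) ^+ L.
  have ie : 0 < 1 - eps by lra.
  rewrite -(ler_pM2l ie); apply: le_trans nr _.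
  rewrite /threshold exprS le_eqVlt; apply/orP; left; apply/eqP.
  by field; lra.
have h' : lam * (1 - eps) ^+ L <= 2 * (top - f base) * (e * e).
  have p0 : 0 <= (1 - eps) ^+ L by rewrite exprn_ge0; lra.
  apply: (@le_trans _ _ (2 * (top - f base) * (1 - eps) ^+ L)).
    by rewrite ler_wpM2r.
  by rewrite ler_wpM2l //; lra.
have h2 : 0 <= e * (2^-1 - e) * (top - f base) by rewrite !mulr_ge0; lra.
have h3 : 0 <= e * f base by rewrite mulr_ge0; lra.
have h4 : 0 <= eps * (1 - e) * top by rewrite !mulr_ge0; lra.
lra.
Qed.

(** Markov's inequality for [excess + 2 * eps * b]: it is at least [wasted] since [spent <= 2 * b],
    its mean is at most [2 * eps * b], and failure forces [wasted > 4 * eps * b]. *)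
Lemma expect_greedy_fail :
  expect f greedy (fun st => (~~ good (out st))%:R) <= 2^-1.
Proof.
have [bp ep e10] := And3 b0 eps0 eps1.
have eb : 0 < 4 * eps * b by rewrite !mulr_gt0 //; lra.
have exc : expect f greedy (excess eps) <= 0.
  apply: (@le_trans _ _ (excess eps (State base base 0 0))); last first.
    by rewrite /excess /=; lra.
  apply: expect_iterate => l st; apply: expect_iterate => k st'.
  apply: expect_step_excess; [exact: ltW|exact: threshold_gt0|].
  by move=> x /cands_cost /andP[].
apply: (@le_trans _ _
  (expect f greedy (fun st => (4 * eps * b)^-1 * excess eps st + 2^-1))).
  apply: (expect_le runs_greedy) => st [ist nst].
  have [_ _ _ _ [s2 _ w0 _]] := ist.
  have sE : (4 * eps * b)^-1 * excess eps st + 2^-1 =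
    (4 * eps * b)^-1 * (wasted st + eps * (2 * b - spent st)).
    by rewrite /excess; field; lra.
  have es : 0 <= eps * (2 * b - spent st) by rewrite mulr_ge0; lra.
  rewrite sE; case: (leP (wasted st) (4 * eps * b)) => [small|big].
    rewrite final_good //= mulr_ge0 ?invr_ge0; lra.
  apply: (@le_trans _ _ 1); first by rewrite lern1 leq_b1.
  by rewrite mulrC ler_pdivlMr // mul1r; lra.
rewrite expect_affine.
have : (4 * eps * b)^-1 * expect f greedy (excess eps) <= 0.
  by rewrite mulr_ge0_le0 // invr_ge0 ltW.
lra.
Qed.

End Greedy.

(** * Enumeration of guesses *)

Section Enumeration.
Variables (R : realType) (N : finType) (a : N -> R).
Implicit Types (f F : {set N} -> R) (A opt : {set N}) (Q : seq {set N}).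
Hypothesis a0 : forall j, 0 <= a j.

Definition zeros : {set N} := [set j | a j == 0].

Definition base_of (y : N * N * N) : {set N} :=
  y.2 |: (y.1.2 |: (y.1.1 |: zeros)).

Definition budget A : R := 1 - \sum_(j in A) a j.

(** Three greedy choices from [opt]: the gain of any [j] at the end is at most each of the three
    gains made, whose sum is at most [f (base_of y)]. *)
Lemma base_of_exists f opt : nonnegative f -> monotone f -> submodular f ->
  opt != set0 ->
  exists2 y, base_of y \subset zeros :|: opt &
    {in opt, forall j, gain f j (base_of y) <= f (base_of y) / 3}.
Proof.
move=> fnn fmono fsub /set0Pn[x0 x0o].
have best A : {y | y \in opt & {in opt, forall j, gain f j A <= gain f y A}}.
  by case: (arg_maxP (fun j => gain f j A) x0o) => y yo my; exists y.
have [y1 y1o m1] := best zeros.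
have [y2 y2o m2] := best (y1 |: zeros).
have [y3 y3o m3] := best (y2 |: (y1 |: zeros)).
exists (y1, y2, y3); rewrite /base_of /=.
  rewrite !subUset !sub1set subsetUl !inE y1o y2o y3o.
  by rewrite !orbT.
move=> j jo.
have := m1 _ jo; have := m2 _ jo; have := m3 _ jo.
have := gain_anti fmono fsub j (subsetUr [set y3] (y2 |: (y1 |: zeros))).
have := gain_anti fmono fsub j (subsetUr [set y2] (y1 |: zeros)).
have := gain_anti fmono fsub j (subsetUr [set y1] zeros).
have := fnn zeros; rewrite /gain; lra.
Qed.

Lemma sum_residual opt A : A \subset zeros :|: opt -> zeros \subset A ->
  \sum_(j in A) a j + \sum_(j in opt :\: A) a j = \sum_(j in opt) a j.
Proof.
move=> Ao zA.
have -> : \sum_(j in opt) a j = \sum_(j in zeros :|: opt) a j.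
  rewrite [RHS](big_setID opt) /= [X in _ = _ + X]big1 ?addr0.
    by apply: eq_bigl => j; rewrite !inE; case: (j \in opt); rewrite ?orbT ?andbF.
  by move=> j; rewrite !inE => /andP[/negbTE->]; rewrite orbF => /eqP.
rewrite [RHS](big_setID A) /=; congr (_ + _).
  by rewrite (setIidPr Ao).
apply: eq_bigl => j; rewrite !inE; case jA: (j \in A) => //=.
by case jz: (j \in zeros); [rewrite (subsetP zA) in jA|rewrite inE in jz; rewrite jz].
Qed.

(** Let [M] be the largest gain in [T] and [G] the value to guess. As [M <= G <= #|N| * M], the
    least multiple of [M] reaching [G] has factor at most [#|N|] and stays below
    [G + M <= 2 * G]. *)
Lemma guess_exists f A (T : {set N}) : monotone f -> submodular f ->
  f A < f (A :|: T) ->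
  exists2 x, x \in T & exists i : 'I_#|N|,
    f (A :|: T) - f A <= i.+1%:R * gain f x A <= 2 * (f (A :|: T) - f A).
Proof.
move=> fmono fsub lt_top; set G := f (A :|: T) - f A.
have G0 : 0 < G by rewrite subr_gt0.
have [T0|[x0 x0T]] := set_0Vmem T.
  by move: lt_top; rewrite T0 setU0 ltxx.
case: (arg_maxP (fun j => gain f j A) x0T) => x xT mx.
exists x => //; set M := gain f x A.
have GM : G <= #|N|%:R * M.
  have := le_sum_gain fmono fsub A T; rewrite -lerBlDl => /le_trans; apply.
  apply: (@le_trans _ _ (\sum_(j in T) M)); first by apply: ler_sum => j /mx.
  rewrite sumr_const -[leLHS]mulr_natl ler_wpM2r ?gain_ge0 // ler_nat.
  exact: max_card.
have MG : M <= G.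
  by rewrite lerD2r; apply: fmono; rewrite setUC setUS // sub1set.
have exn : exists n, G <= n%:R * M by exists #|N|.
case: (ex_minnP exn) => -[|n]; first by rewrite mul0r; lra.
move=> Gn minn; have nN : (n < #|N|)%N by apply: minn.
exists (Ordinal nN); rewrite Gn /=.
have : n%:R * M < G.
  by rewrite ltNge; apply/negP => /minn; rewrite ltnn.
by rewrite -natr1 mulrDl mul1r; lra.
Qed.

Variable eps : R.

(* Three elements of [opt], an element [x], and the rank [i] such that
   [i.+1%:R * gain f x base] estimates the value that [opt] adds to [base]. *)
Definition index : finType := (N * N * N * N * 'I_#|N|)%type.

Definition branch K L (y : index) : prog R N {set N} :=
  let base := base_of y.1.1 in let b := budget base in
  ask (around base) (fun F =>
    let cands := [set x | (0 < a x <= b) && (gain F x base <= F base / 3)] in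
    let lam := y.2.+1%:R * gain F y.1.2 base in
    bind (greedy a b eps lam base cands K L) (fun st => Ret (out st))).

Definition best F Q : {set N} :=
  [arg max_(A > set0 | (A \in Q) && feasible a A) F A]%O.

(** The empty set and all bases compete too, for the cases of [branch_success] that rely on no
    greedy run. *)
Definition knapsack_prog K L m : prog R N {set N} :=
  bind (parallel [seq branch K L p.2 |
                   p <- [seq (c, y) | c <- iota 0 m, y <- enum index]])
    (fun l => let Q := set0 :: [seq base_of y.1.1 | y : index <- enum index] ++ l in
      ask Q (fun F => Ret (best F Q))).

Definition branch_queries K L := (#|N|.+1 + L * (K * step_queries N))%N.

Lemma runs_branch f K L y :
  runs f (fun=> True) (L * (K * 2)).+1 (branch_queries K L) (branch K L y).
Proof.
rewrite /branch /ask /= size_map -cardE; split=> //; first exact: leq_addr.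
rewrite /branch_queries addKn.
apply: (@runs_weaken _ _ _ _ (fun=> True) _ (L * (K * 2) + 0) _
  (L * (K * step_queries N) + 0)) => //; [by rewrite addn0|by rewrite addn0|].
apply: (runs_bind (P := fun=> True) (d2 := 0) (q2 := 0)) => //.
exact: runs_greedy_cost.
Qed.

Lemma size_runs m :
  size [seq (c, y) | c <- iota 0 m, y <- enum index] = (m * #|N| ^ 5)%N.
Proof.
rewrite size_allpairs size_iota -cardE !card_prod card_ord.
by rewrite !expnS expn0 muln1 !mulnA.
Qed.

Lemma runs_knapsack_prog f K L m :
  runs f (fun=> True) (L * (K * 2)).+2
    (m * #|N| ^ 5 * branch_queries K L + (#|N| ^ 5 + m * #|N| ^ 5).+1)
    (knapsack_prog K L m).
Proof.
rewrite -addn1 -(size_runs m).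
apply: runs_bind.
  by apply: runs_parallel => p; apply: runs_branch.
move=> l sl; rewrite /ask /=; split=> //.
rewrite size_cat size_map sl -cardE ltnS leq_add2r.
by rewrite !card_prod card_ord !expnS expn0 muln1 !mulnA.
Qed.

Lemma best_approx f alpha Q A : set0 \in Q -> A \in Q ->
  knapsack_approx a f alpha A ->
  knapsack_approx a f alpha (best (lookup Q (map f Q)) Q).
Proof.
move=> Q0 AQ /andP[fA vA]; rewrite /best.
have feas0 : (set0 \in Q) && feasible a set0.
  by rewrite Q0 /feasible big_set0 ler01.
pose P A := (A \in Q) && feasible a A.
case: (arg_maxP (P := P) (lookup Q (map f Q)) feas0) => B /andP[BQ fB] mB.
rewrite /knapsack_approx fB /=; apply: le_trans vA _.
by rewrite -!(lookupE f (Q := Q)) //; apply: mB; rewrite /P AQ.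
Qed.

Lemma knapsack_opt_attained f : nonnegative f ->
  exists2 opt, feasible a opt & knapsack_opt a f = f opt.
Proof.
move=> fnn; have feas0 : feasible a set0 by rewrite /feasible big_set0 ler01.
have [opt fo e] := @eq_bigmax _ _ _ 0 set0 (feasible a) f feas0 (fun A _ => fnn A).
by exists opt.
Qed.

Lemma expect_ge0 f T (c : prog R N T) (E : T -> bool) :
  0 <= expect f c (fun x => (E x)%:R).
Proof. by rewrite -(expect_cst f c 0); apply: expect_mono => x. Qed.

Lemma expect_le1 f T (c : prog R N T) (E : T -> bool) :
  expect f c (fun x => (E x)%:R) <= 1.
Proof.
by rewrite -[leRHS](expect_cst f c 1); apply: expect_mono => x; rewrite lern1 leq_b1.
Qed.

Lemma expect_ask f T Q (k : ({set N} -> R) -> prog R N T) g :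
  expect f (ask Q k) g = expect f (k (lookup Q (map f Q))) g.
Proof. by []. Qed.

(** * Success probability of the parallel search *)

Section Success.
Variables (f : {set N} -> R) (K L : nat).
Hypotheses (fnn : nonnegative f) (fmono : monotone f) (fsub : submodular f).
Hypotheses (eps0 : 0 < eps) (eps1 : eps <= 10^-1).
Hypothesis K_large : (1 - eps) ^+ K * #|N|%:R < 1.
Hypothesis L_large : 2 <= L%:R * eps.

Let alpha := (1 - 10 * eps) * (1 - expR (- 1)).
Let approx := knapsack_approx a f alpha.

Let alpha01 : 0 <= alpha <= 1.
Proof.
have /andP[e3 e2] := expRN1_bounds R; have := eps0; have := eps1 => h1 h2.
apply/andP; split; first by rewrite mulr_ge0; lra.
by rewrite mulr_ile1; lra.
Qed.

Let approxI A : feasible a A -> knapsack_opt a f <= f A -> approx A.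
Proof.
move=> fA oA; rewrite /approx /knapsack_approx fA /=.
have /andP[h0 h1] := alpha01.
apply: le_trans (ler_wpM2l h0 oA) _.
by rewrite ler_piMl.
Qed.

(** Either the optimum is empty, or the guessed base is worth as much as its union with the optimum,
    or [opt :\: base] has value to add and a right guess meets the hypotheses of
    [expect_greedy_fail]. *)
Lemma branch_success :
  approx set0 \/ (exists y, approx (base_of y)) \/
  exists y, expect f (branch K L y) (fun A => (~~ approx A)%:R) <= 2^-1.
Proof.
have [opt fopt optE] := knapsack_opt_attained fnn.
have [opt0|optN0] := eqVneq opt set0.
  by left; apply: approxI; [rewrite -opt0|rewrite optE opt0].
right; have [y3 y3o y3g] := base_of_exists fnn fmono fsub optN0.
set base := base_of y3 in y3o y3g.
have zb : zeros \subset base by rewrite /base /base_of !setUA subsetUr.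
have split_opt := sum_residual y3o zb.
have topE : base :|: (opt :\: base) = base :|: opt.
  by rewrite setDE setUIr setUCr setIT.
have res0 : 0 <= \sum_(j in opt :\: base) a j by apply: sumr_ge0.
have fb : feasible a base by move: fopt; rewrite /feasible; lra.
have opt_top : knapsack_opt a f <= f (base :|: opt :\: base).
  by rewrite topE optE fmono // subsetUr.
have [small|lt_top] := leP (f (base :|: (opt :\: base))) (f base).
  by left; exists y3; apply: approxI => //; apply: le_trans opt_top small.
right; have [x xT [i /andP[lam_ge lam_le]]] := guess_exists fmono fsub lt_top.
exists (y3, x, i); rewrite /branch expect_ask -/base.
have := lookupE f (Q := around base); move: (lookup _ _) => F FE.
rewrite /= expect_bind (eq_gain _ FE) (FE base) ?mem_head //.
set b := budget base; set cands := [set _ | _].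
have candsE z : (z \in cands) = (0 < a z <= b) && (gain f z base <= f base / 3).
  by rewrite inE (eq_gain _ FE).
have bE : b = 1 - \sum_(j in base) a j by [].
(* Residual elements have positive cost because [base] contains [zeros], and each fits the budget
   because the whole residual does. *)
have sub_cands : opt :\: base \subset cands.
  apply/subsetP => z zT; have := zT; rewrite candsE inE => /andP[zb' zo].
  rewrite y3g // andbT lt0r a0 andbT; apply/andP; split.
    by apply: contra zb' => z0; rewrite (subsetP zb) // inE.
  have : a z <= \sum_(j in opt :\: base) a j.
    by rewrite (bigD1 z zT) /= lerDl sumr_ge0.
  by move: fopt; rewrite /feasible; lra.
have b0 : 0 < b.
  have := subsetP sub_cands _ xT; rewrite candsE => /andP[/andP[h1 h2] _].
  exact: lt_le_trans h1 h2.
have res_b : \sum_(j in opt :\: base) a j <= b.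
  by move: fopt; rewrite /feasible; lra.
have base_b : \sum_(j in base) a j <= 1 - b by lra.
have cost z : z \in cands -> 0 < a z <= b by rewrite candsE => /andP[].
have cgain z : z \in cands -> gain f z base <= f base / 3.
  by rewrite candsE => /andP[].
apply: le_trans (expect_greedy_fail fmono fsub b0 eps0 eps1 sub_cands res_b
  base_b cost cgain (fnn base) lt_top lam_ge lam_le K_large L_large).
apply: expect_mono => st /=; rewrite ler_nat.
have gd : good a eps f base (opt :\: base) (out st) -> approx (out st).
  move=> /andP[fo vo]; rewrite /approx /knapsack_approx fo /=.
  by apply: le_trans vo; apply: ler_wpM2l => //; case/andP: alpha01.
by case: (good _ _ _ _ _ _) gd => [->|_] //; case: (approx _).
Qed.

(** The [m] copies of a good branch fail independently; every other branch only contributes a factor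
    at most 1 to the probability that all fail. *)
Lemma knapsack_prog_success m :
  1 - 2^-1 ^+ m <= expect f (knapsack_prog K L m) (fun A => (approx A)%:R).
Proof.
set idx := enum index.
pose Qof l := set0 :: [seq base_of y.1.1 | y : index <- idx] ++ l.
have sure l : (exists2 A, A \in Qof l & approx A) ->
    expect f (ask (Qof l) (fun F => Ret (best F (Qof l)))) (fun A => (approx A)%:R) = 1.
  move=> [A AQ okA]; rewrite expect_ask /=.
  by rewrite /approx (best_approx _ AQ okA) // mem_head.
have le1 : 1 - 2^-1 ^+ m <= 1 :> R by rewrite gerBl exprn_ge0.
rewrite /knapsack_prog expect_bind -/idx.
have [ok|[[y ok]|[y fail]]] := branch_success.
- rewrite (@eq_expect _ _ f _ _ _ (fun=> 1)) ?expect_cst // => l.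
  by apply: sure; exists set0; rewrite ?mem_head.
- rewrite (@eq_expect _ _ f _ _ _ (fun=> 1)) ?expect_cst // => l.
  apply: sure; exists (base_of y) => //.
  have n0 : (0 < #|N|)%N by apply/card_gt0P; exists y.2.
  rewrite in_cons mem_cat; apply/orP; right; apply/orP; left.
  apply/mapP; exists (y, y.2, Ordinal n0) => //.
  by rewrite /idx mem_enum.
set cs := [seq (c, z) | c <- iota 0 m, z <- idx].
have := expect_parallel_all f (fun p : nat * index => branch K L p.2) cs
  (fun A => ~~ approx A).
set br := fun p => _; set par_runs := parallel _.
move=> prodE.
apply: (@le_trans _ _ (expect f par_runs
    (fun l => - 1 * (all (fun A => ~~ approx A) l)%:R + 1))).
  rewrite expect_affine prodE mulN1r [leRHS]addrC lerD2l lerN2.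
  rewrite big_allpairs /=.
  apply: (@le_trans _ _ (\prod_(c <- iota 0 m) 2^-1)); last first.
    by rewrite big_const_seq count_predT size_iota iter_mulr_1.
  apply: ler_prod => c _; apply/andP; split.
    by apply: prodr_ge0 => z _; apply: expect_ge0.
  rewrite /idx big_enum /= (bigD1 y) //=.
  apply: le_trans fail; rewrite ler_piMr ?expect_ge0 //.
  by apply: prodr_ile1 => z _; rewrite expect_ge0 expect_le1.
apply: expect_mono => l; have [al|nal] := boolP (all _ l).
  by rewrite mulr1 addNr expect_ge0.
rewrite sure ?mulr0 ?add0r //.
move/allPn: nal => [A Al]; rewrite negbK => okA; exists A => //.
by rewrite in_cons mem_cat Al !orbT.
Qed.

End Success.
End Enumeration.

(** * Choice of the parameters *)

Section Schedule.
Variables (R : realType) (n : nat) (eps delta : R).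
Hypotheses (n2 : (2 <= n)%N) (eps0 : 0 < eps) (eps1 : eps <= 10^-1).
Hypothesis delta01 : 0 < delta < 1.

Definition num_steps : nat := (Num.truncn (ln (n%:R : R) / eps)).+1.
Definition num_levels : nat := (Num.truncn (2 / eps)).+1.
Definition num_copies : nat := (Num.truncn delta^-1).+1.

Let x := eps^-1.
Let l : R := ln n%:R.

Let x10 : 10 <= x.
Proof. by rewrite /x -[10]invrK lef_pV2 ?posrE // invr_gt0. Qed.

Let n_ge2 : 2 <= n%:R :> R.
Proof. by rewrite (ler_nat R 2). Qed.

(** Since [exp (1/2) <= 2 <= n]. Being bounded away from 0, [l] absorbs the additive constants of
    the round count. *)
Let l_ge : 2^-1 <= l.
Proof.
have nn := n_ge2; have h := @expR_le1D2x R 2^-1.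
have n0 : 0 < n%:R :> R by lra.
rewrite /l -[leLHS]expRK ler_ln ?posrE ?expR_gt0 //.
by apply: le_trans (h _) _; [apply/andP; split; lra|lra].
Qed.

Let l_le : l <= n%:R.
Proof.
have h : 0 < n%:R :> R by have := n_ge2; lra.
have := expR_ge1Dx l; rewrite /l lnK ?posrE //; lra.
Qed.

Let trunc_bounds (z : R) : 0 <= z -> z <= (Num.truncn z).+1%:R <= z + 1.
Proof.
by move=> /truncn_itv/andP[h1 h2]; rewrite (ltW h2) -natr1 lerD2r.
Qed.

Let steps_bounds : l * x <= num_steps%:R <= l * x + 1.
Proof. by apply: trunc_bounds; rewrite mulr_ge0 //; have := l_ge; have := x10; lra. Qed.

Let levels_bounds : 2 * x <= num_levels%:R <= 2 * x + 1.
Proof. by apply: trunc_bounds; rewrite mulr_ge0 //; have := x10; lra. Qed.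

Let copies_bounds : delta^-1 <= num_copies%:R <= delta^-1 + 1.
Proof. by apply: trunc_bounds; rewrite invr_ge0; case/andP: delta01 => /ltW. Qed.

Lemma num_steps_large : (1 - eps) ^+ num_steps * n%:R < 1.
Proof.
have h : 0 < n%:R :> R by have := n_ge2; lra.
have e1 : 0 <= eps <= 1 by have := eps0; have := eps1; lra.
apply: (@le_lt_trans _ _ (expR (- (num_steps%:R * eps)) * n%:R)).
  by rewrite ler_wpM2r ?expr_1B_le_expR // ltW.
rewrite -ltr_pdivlMr // mul1r -[X in _ < X^-1]lnK ?posrE // -expRN ltr_expR.
by rewrite ltrN2 -ltr_pdivrMr // truncnS_gt.
Qed.

Lemma num_levels_large : 2 <= num_levels%:R * eps.
Proof. by rewrite -ler_pdivrMr //; case/andP: levels_bounds. Qed.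

Lemma num_copies_large : 2^-1 ^+ num_copies <= delta.
Proof.
have /andP[d0 d1] := delta01; have /andP[h _] := copies_bounds.
rewrite exprVn -[leRHS]invrK lef_pV2 ?posrE ?exprn_gt0 ?invr_gt0 //.
apply: le_trans h _; rewrite -natrX ler_nat; exact/ltnW/ltn_expl.
Qed.

Lemma depth_bound :
  (num_levels * (num_steps * 2)).+2%:R <= 10 * (l / eps ^+ 2).
Proof.
have /andP[_ hK] := steps_bounds; have /andP[_ hL] := levels_bounds.
have xx := x10; have ll := l_ge.
rewrite -exprVn -/x -addn2 natrD !natrM.
have lx : 5 <= l * x.
  have -> : 5 = 2^-1 * 10 :> R by field.
  by apply: ler_pM; lra.
have lxx : 5 * 10 <= l * x * x by apply: ler_pM; lra.
have K0 : 0 <= num_steps%:R :> R by [].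
have L0 : 0 <= num_levels%:R :> R by [].
have : num_levels%:R * num_steps%:R <= (21 / 10 * x) * (6 / 5 * (l * x)).
  by apply: ler_pM => //; lra.
rewrite expr2; lra.
Qed.

(** Copies and guesses have degree 6 in [T]; a branch has degree 5: levels 1, steps 2 (by
    [ln n <= n]), queries per step 2. *)
Lemma query_bound :
  (num_copies * n ^ 5 *
     (n.+1 + num_levels * (num_steps * (n.+1 + n.+1 * n.+1))) +
     (n ^ 5 + num_copies * n ^ 5).+1)%:R
  <= 10 * (n%:R + eps^-1 + delta^-1) ^+ 11.
Proof.
have /andP[d0 d1] := delta01.
have y1 : 1 <= delta^-1 by rewrite invf_ge1 // ltW.
have /andP[_ hK] := steps_bounds; have /andP[_ hL] := levels_bounds.
have /andP[_ hM] := copies_bounds.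
have xx := x10; have ll := l_ge; have ln := l_le; have nn := n_ge2.
rewrite -/x; set T := n%:R + x + delta^-1.
have T1 : 1 <= T by rewrite /T; lra.
have natM u v (A B : R) : u%:R <= A -> v%:R <= B -> (u * v)%N%:R <= A * B.
  by move=> uA vB; rewrite natrM ler_pM.
have natD u v (A B : R) : u%:R <= A -> v%:R <= B -> (u + v)%N%:R <= A + B.
  by move=> uA vB; rewrite natrD lerD.
have nT : n%:R <= T by rewrite /T; lra.
have n1T : n.+1%:R <= T by rewrite -natr1 /T; lra.
have mT : num_copies%:R <= T by rewrite /T; lra.
have LT : num_levels%:R <= 3 * T by rewrite /T; lra.
have KT : num_steps%:R <= T ^+ 2.
  apply: le_trans hK _.
  have h1 : l * x <= n%:R * x by rewrite ler_wpM2r; lra.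
  have h2 : 1 <= n%:R * n%:R :> R by nra.
  have h3 : 0 <= n%:R * x by apply: mulr_ge0; lra.
  have h4 : (n%:R + x) ^+ 2 <= T ^+ 2.
    by apply: lerXn2r; rewrite ?nnegrE /T; lra.
  apply: le_trans h4; have := sqr_ge0 x; rewrite !expr2; lra.
have n5 : (n ^ 5)%:R <= T ^+ 5.
  by rewrite natrX; apply: lerXn2r; rewrite ?nnegrE //; lra.
have mono i j : (i <= j)%N -> T ^+ i <= T ^+ j by move=> ij; apply: ler_weXn2l.
have hs : (n.+1 + n.+1 * n.+1)%:R <= 2 * T ^+ 2.
  apply: le_trans (natD _ _ _ _ n1T (natM _ _ _ _ n1T n1T)) _.
  have := mono 1 2 isT; rewrite !expr2 expr1; lra.
have hb : (n.+1 + num_levels * (num_steps * (n.+1 + n.+1 * n.+1)))%:R <= 7 * T ^+ 5.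
  apply: le_trans (natD _ _ _ _ n1T (natM _ _ _ _ LT (natM _ _ _ _ KT hs))) _.
  have -> : 3 * T * (T ^+ 2 * (2 * T ^+ 2)) = 6 * T ^+ 5 by ring.
  have := mono 1 5 isT; rewrite expr1; lra.
have h6 := natM _ _ _ _ mT n5.
rewrite addnS -natr1.
apply: le_trans (lerD (natD _ _ _ _ (natM _ _ _ _ h6 hb)
  (natD _ _ _ _ n5 h6)) (lexx 1)) _.
have -> : T * T ^+ 5 * (7 * T ^+ 5) = 7 * T ^+ 11 by ring.
rewrite -exprS.
have := mono 5 11 isT; have := mono 6 11 isT; have := mono 0 11 isT.
rewrite expr0; lra.
Qed.

End Schedule.

(** The algorithm is fixed before [f], which it sees through queries only. As copies run in
    parallel, [delta] affects the number of queries but not the depth. *)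
Theorem theoremB9 (R : realType) :
  exists (c1 c2 c3 : R) (k : nat),
    [/\ 0 < c1, 0 < c2 & 0 < c3] /\
    forall (N : finType) (a : N -> R) (eps delta : R),
      (forall j : N, 0 <= a j <= 1) -> 0 < eps -> 0 < delta < 1 ->
      exists alg : oracle_alg R N,
        forall f : {set N} -> R,
          nonnegative f -> normalized f -> monotone f -> submodular f ->
          [/\ (depth f alg)%:R <= c1 * (ln (#|N|%:R) / eps ^+ 2),
              (nqueries f alg)%:R
                <= c3 * (#|N|%:R + eps^-1 + delta^-1) ^+ k
            & 1 - delta <=
              output_prob f alg
                (knapsack_approx a f ((1 - c2 * eps) * (1 - expR (- 1))))].
Proof.
exists 10, 10, 10, 11%N; split=> // N a eps delta a01 eps0 delta01.
have /andP[d0 d1] := delta01.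
have /andP[e3 e2] := expRN1_bounds R.
have a0 j : 0 <= a j by case/andP: (a01 j).
have ln0 : 0 <= ln (#|N|%:R : R).
  have [->|n0] := posnP #|N|; first by rewrite exp.ln0.
  by apply: ln_ge0; rewrite ler1n.
have depth0 : 0 <= 10 * (ln (#|N|%:R) / eps ^+ 2).
  by rewrite mulr_ge0 // divr_ge0 // sqr_ge0.
have queries0 : 0 <= 10 * (#|N|%:R + eps^-1 + delta^-1) ^+ 11.
  by rewrite mulr_ge0 // exprn_ge0 // !addr_ge0 // invr_ge0 ltW.
have trivial_alg A :
    (forall f, nonnegative f -> monotone f ->
      knapsack_approx a f ((1 - 10 * eps) * (1 - expR (- 1))) A) ->
    exists alg : oracle_alg R N, forall f : {set N} -> R,
      nonnegative f -> normalized f -> monotone f -> submodular f ->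
      [/\ (depth f alg)%:R <= 10 * (ln (#|N|%:R) / eps ^+ 2),
          (nqueries f alg)%:R <= 10 * (#|N|%:R + eps^-1 + delta^-1) ^+ 11
        & 1 - delta <= output_prob f alg
            (knapsack_approx a f ((1 - 10 * eps) * (1 - expR (- 1))))].
  move=> okA; exists (Output R A) => f fnn _ fmono _ /=.
  by rewrite okA //; split=> //; rewrite gerBl ltW.
have opt_ge0 f : nonnegative f -> 0 <= knapsack_opt a f.
  by move=> fnn; have [opt _ ->] := knapsack_opt_attained a fnn.
(* For [eps >= 1/10] the approximation factor is at most 0, so the empty set will do. *)
have [eps_big|eps_small] := leP 10^-1 eps.
  apply: (trivial_alg set0) => f fnn _.
  rewrite /knapsack_approx /feasible big_set0 ler01 /=.
  apply: le_trans (fnn set0); apply: mulr_le0_ge0; last exact: opt_ge0.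
  by apply: mulr_le0_ge0; lra.
(* Here [ln #|N|] is 0, so no round is allowed; the full set is feasible, as a single cost is at
   most 1. *)
have [n1|n2] := leqP #|N| 1.
  apply: (trivial_alg setT) => f fnn fmono; apply/andP; split.
    rewrite /feasible; have [T0|[j _]] := set_0Vmem [set: N].
      by rewrite T0 big_set0 ler01.
    rewrite (bigD1 j) //= big1 ?addr0; first by case/andP: (a01 j).
    move=> i /andP[_ /eqP[]]; exact: (fintype_le1P n1).
  have le_opt : knapsack_opt a f <= f setT.
    by have [opt _ ->] := knapsack_opt_attained a fnn; apply: fmono; apply: subsetT.
  apply: le_trans le_opt; rewrite ler_piMl ?opt_ge0 //.
  by rewrite mulr_ile1; lra.
pose K := num_steps #|N| eps; pose L := num_levels eps; pose m := num_copies delta.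
exists (alg_of (knapsack_prog a eps K L m)) => f fnn _ fmono fsub.
have [dle qle] := runs_alg_of (runs_knapsack_prog a eps f K L m).
split.
- apply: le_trans (depth_bound n2 eps0 (ltW eps_small)).
  by rewrite ler_nat.
- apply: le_trans (query_bound n2 eps0 (ltW eps_small) delta01).
  by rewrite ler_nat.
- rewrite output_prob_alg_of.
  apply: le_trans (knapsack_prog_success a0 fnn fmono fsub eps0 (ltW eps_small) _ _ _).
  + by rewrite lerD2l lerN2; apply: num_copies_large.
  + exact: num_steps_large n2 eps0 (ltW eps_small).
  + exact: num_levels_large eps0 (ltW eps_small).
Qed.
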